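(* Let $V$ be a finite ground set, $f:2^V\to\mathbb{R}_{\ge0}$ a normalized monotone submodular function with submodular curvature $c\in[0,1)$, $g:2^V\to\mathbb{R}_{\ge0}$ a normalized monotone supermodular function with supermodular curvature $\gamma\in[0,1)$, $\theta>0$, and $S^*$ an optimal solution of $\max\{f(S): g(S)\le\theta\}$. Let $S_k$ be the set returned by the Greedy-Ratio-Marginal algorithm that overshoots the constraint by at most one element (i.e. $k$ is the first index with $g(S_k)>\theta$). Then $$f(S_k)\ge\left(1-\left[1-(1-c)(1-\gamma)\right]^{\frac{1}{1-c}}\right)f(S^* ).$$
   Context: A function $f$ is normalized if $f(\emptyset)=0$; monotone if $f(A)\le f(B)$ for $A\subseteq B$; submodular if $f(A\cup\{e\})-f(A)\ge f(B\cup\{e\})-f(B)$ for all $A\subseteq B\subseteq V$, $e\in V\setminus B$; supermodular if the reverse inequality holds. Marginals: $g(T\mid S)=g(T\cup S)-g(S)$, $f(v\mid S)=f(S\cup\{v\})-f(S)$, $f(v)=f(\{v\})$. The submodular curvature of $f$ is $c=1-\min_{v,S}\frac{f(v\mid S)}{f(v)}$. The supermodular curvature of $g$ is $\gamma = 1-\min_{S,T\subseteq V:\ g(T)\ge g(S)} \frac{g(T)}{g(T\mid S)}$. The Greedy-Ratio-Marginal algorithm starts from $S_0=\emptyset$ and for $i=0,1,2,\dots$ chooses $v_{i+1}\in\arg\max_{v\notin S_i}\frac{f(v\mid S_i)}{g(v\mid S_i)}$ and sets $S_{i+1}=S_i\cup\{v_{i+1}\}$. *)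

(* Defs.v *)
From HB Require Import structures.
From mathcomp Require Import all_boot all_order all_algebra.
From mathcomp Require Import constructive_ereal reals exp.

Set Implicit Arguments.
Unset Strict Implicit.
Unset Printing Implicit Defensive.

Import Order.TTheory GRing.Theory Num.Theory.
Local Open Scope ring_scope.

Section SetFunctions.
Context {R : realType} {V : finType}.
Implicit Types (h f g : {set V} -> R) (A B S T : {set V}) (v : V).

Definition normalized h : Prop := h set0 = 0.

Definition monotone h : Prop := forall A B, A \subset B -> h A <= h B.

(* [marginal h T S] is h(T | S); the single-element marginal h(v | S) is
   [marginal h [set v] S]. *)
Definition marginal h T S : R := h (S :|: T) - h S.

Definition submodular h : Prop :=
  forall A B v, A \subset B -> v \notin B ->
    marginal h [set v] B <= marginal h [set v] A.

Definition supermodular h : Prop :=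
  forall A B v, A \subset B -> v \notin B ->
    marginal h [set v] A <= marginal h [set v] B.

(* In both curvatures the minimum runs over the quotients with nonzero
   denominator: a/0 with a > 0 is +oo, and 0/0 is discarded.  For the submodular
   curvature S ranges over the subsets of V \ {v} (otherwise f(v | S) = 0 and the
   curvature would always be 1).  The default value 1 is never smaller than the
   intended minimum: for normalized functions S = set0 yields the quotient 1 as
   soon as some quotient is admissible, and it only matters (curvature 0) when
   there is none, i.e. for a function that is identically 0. *)
Definition submodular_curvature f : R :=
  1 - \big[Num.min/1]_(p : V * {set V} | (p.1 \notin p.2) && (f [set p.1] != 0))
        (marginal f [set p.1] p.2 / f [set p.1]).

(* Here a pair p is (S, T). *)
Definition supermodular_curvature g : R :=
  1 - \big[Num.min/1]_(p : {set V} * {set V}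
                         | (g p.1 <= g p.2) && (marginal g p.2 p.1 != 0))
        (g p.2 / marginal g p.2 p.1).

(* Ratio a / b of nonnegative reals with a / 0 = +oo for a > 0; the
   indeterminate 0 / 0 is given the value [r0]. *)
Definition ratio (r0 : \bar R) (a b : R) : \bar R :=
  if b != 0 then (a / b)%:E else if a != 0 then +oo%E else r0.

Definition greedy_ratio r0 f g S v : \bar R :=
  ratio r0 (marginal f [set v] S) (marginal g [set v] S).

(* v is in the argmax, over the elements outside S, of f(v | S) / g(v | S). *)
Definition greedy_choice r0 f g S v : Prop :=
  v \notin S /\
  forall u, u \notin S -> (greedy_ratio r0 f g S u <= greedy_ratio r0 f g S v)%E.

(* S_ 0, ..., S_ k are the first iterates of some execution of
   Greedy-Ratio-Marginal, with arbitrary tie-breaking. *)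
Definition greedy_ratio_marginal r0 f g (S_ : nat -> {set V}) (k : nat) : Prop :=
  S_ 0%N = set0 /\
  forall i, (i < k)%N ->
    exists2 v, greedy_choice r0 f g (S_ i) v & S_ i.+1 = S_ i :|: [set v].

Definition first_overshoot g (theta : R) (S_ : nat -> {set V}) (k : nat) : Prop :=
  theta < g (S_ k) /\ forall i, (i < k)%N -> g (S_ i) <= theta.

Definition optimal_solution f g (theta : R) (Sstar : {set V}) : Prop :=
  g Sstar <= theta /\ forall S, g S <= theta -> f S <= f Sstar.

End SetFunctions.

(* Main.v *)
Require Import Defs.
From mathcomp Require Import all_boot all_order all_algebra.
From mathcomp Require Import constructive_ereal reals exp.
From mathcomp Require Import ring lra.

(** Write [a = 1 - c], [b = 1 - gamma] and [Y] for the optimum.  The greedy rule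
    bounds the marginals of [f] at [S_i] by those of [g], so that
    [f(Y | S_i) <= rho_i g(Y | S_i)] with [rho_i = df_i / dg_i]; the ratios
    [rho_i] are nonincreasing, and with the curvature of [f] this gives
    [f(S_i :|: Y) - f(Y) >= a rho_i g(S_i :\: Y)].  Since
    [g(Y | S_i :\: Y) <= theta / b], the two bounds combine to
    [f(Y) - f(S_i) <= rho_i (theta / b - a g(S_i))].
    Bernoulli's inequality then keeps [f(Y) - f(S_i)] below
    [f(Y) (1 - a b t_i)^(1/a)], where [t_i = min(g(S_i), theta) / theta], and
    [t_k = 1].  All estimates on [rho_i] are cross-multiplied, as [dg_i] may
    vanish. *)

Import Order.TTheory GRing.Theory Num.Theory.
Local Open Scope ring_scope.

(** Young's inequality for [u] and 1 with conjugate exponents [s] and [s / (s - 1)]; [s = 1] has no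
    finite conjugate and is treated apart. *)
Lemma powR_bernoulli {R : realType} (s u : R) :
  1 <= s -> 0 <= u -> 1 + s * (u - 1) <= u `^ s.
Proof.
move=> s1 u0; have s0 : 0 < s by lra.
have [->|sN1] := eqVneq s 1; first by rewrite powRr1// mul1r; lra.
have t0 : 0 < s - 1 by rewrite subr_gt0 lt_neqAle eq_sym sN1.
have q0 : 0 < s / (s - 1) by rewrite divr_gt0.
have := @conjugate_powR R u 1 s (s / (s - 1)) u0 ler01 s0 q0.
rewrite powR1 mulr1 => /(_ _)/wrap[]; first by field; rewrite !gt_eqF.
rewrite -(ler_pM2l s0) => H.
have E : s * (u `^ s / s + 1 / (s / (s - 1))) = u `^ s + s - 1.
  by field; rewrite !gt_eqF.
by move: H; rewrite E; lra.
Qed.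

(** * Marginals, curvatures and the greedy comparison *)

Section SetFunctions.
Context {R : realType} {V : finType}.
Implicit Types (f g h : {set V} -> R) (A B S T X Y : {set V}) (u v : V) (p q : R).

Lemma marginal_ge0 {h} S T : monotone h -> 0 <= marginal h T S.
Proof. by move=> mh; rewrite subr_ge0; apply: mh; exact: subsetUl. Qed.

Lemma marginal_in {h} {v S} : v \in S -> marginal h [set v] S = 0.
Proof. by move=> vS; rewrite /marginal (setUidPl _) ?sub1set// subrr. Qed.

Lemma submodular_curvature_marginal {f v S} : monotone f -> 0 <= f [set v] ->
  v \notin S ->
  (1 - submodular_curvature f) * f [set v] <= marginal f [set v] S.
Proof.
move=> mf fv0 vS; have [->|fv] := eqVneq (f [set v]) 0.
  by rewrite mulr0 marginal_ge0.
rewrite /submodular_curvature subKr -ler_pdivlMr ?lt_def ?fv//.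
by apply: (@bigmin_le_cond _ _ _ _ (v, S)); rewrite /= vS fv.
Qed.

Lemma supermodular_curvature_marginal {g S T} : monotone g -> 0 <= g T ->
  g S <= g T -> (1 - supermodular_curvature g) * marginal g T S <= g T.
Proof.
move=> mg gT ST; have [->|m0] := eqVneq (marginal g T S) 0; first by rewrite mulr0.
rewrite /supermodular_curvature subKr -ler_pdivlMr ?lt_def ?m0 ?marginal_ge0//.
by apply: (@bigmin_le_cond _ _ _ _ (S, T)); rewrite /= ST m0.
Qed.

(* When [g T < g S] the curvature only bounds g(S | T); the two marginals are
   related by g(T | S) = g(S | T) + g(T) - g(S). *)
Lemma supermodular_curvature_budget {g theta S T} :
  monotone g -> (forall A, 0 <= g A) -> 0 <= supermodular_curvature g < 1 ->
  g S <= theta -> g T <= theta ->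
  (1 - supermodular_curvature g) * marginal g T S <= theta.
Proof.
move=> mg g0 /andP[c0 c1] St Tt; case: (leP (g S) (g T)) => ST.
  exact: le_trans (supermodular_curvature_marginal mg (g0 T) ST) Tt.
have := supermodular_curvature_marginal mg (g0 S) (ltW ST).
rewrite /marginal [T :|: S]setUC => H.
have : 0 <= (1 - supermodular_curvature g) * (g S - g T) by rewrite mulr_ge0; lra.
lra.
Qed.

(** Enlarging the base beyond [X] only lowers marginals of [f] and raises those of [g], so the
    singleton inequality at [X] survives adding [Y] element by element. *)
Lemma marginal_ratio_set {f g p q X} Y : submodular f -> supermodular g ->
  0 <= p -> 0 <= q ->
  (forall v, v \notin X -> q * marginal f [set v] X <= p * marginal g [set v] X) ->
  q * marginal f Y X <= p * marginal g Y X.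
Proof.
move=> sf sg p0 q0 H; move: {2}#|Y| (erefl #|Y|) => n.
elim: n Y => [|n IH] Y Yn.
  by move/eqP: Yn; rewrite cards_eq0 => /eqP ->; rewrite /marginal setU0 !subrr !mulr0.
have [Y0|[v vY]] := set_0Vmem Y; first by rewrite Y0 cards0 in Yn.
have {}/IH IH : #|Y :\ v| = n by move: Yn; rewrite (cardsD1 v) vY => -[].
have E h : marginal h Y X = marginal h [set v] (X :|: Y :\ v) + marginal h (Y :\ v) X.
  by rewrite /marginal -setUA [_ :|: [set v]]setUC setD1K// addrA subrK.
rewrite !E [leLHS]mulrDr [leRHS]mulrDr lerD//.
case: (boolP (v \in X :|: Y :\ v)) => vX; first by rewrite !(marginal_in vX) !mulr0.
apply: le_trans (ler_wpM2l q0 (sf _ _ _ (subsetUl X _) vX)) _.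
apply: le_trans (ler_wpM2l p0 (sg _ _ _ (subsetUl X _) vX)).
by apply: H; apply: contra vX; rewrite inE => ->.
Qed.

(* Cross-multiplied, the greedy rule has no exceptional 0/0 or a/0 case. *)
Lemma greedy_choice_cross {r0 f g S v u} : monotone f -> monotone g ->
  greedy_choice r0 f g S v -> u \notin S ->
  marginal g [set v] S * marginal f [set u] S
    <= marginal f [set v] S * marginal g [set u] S.
Proof.
move=> mf mg [_ H] /H; rewrite /greedy_ratio /Defs.ratio.
have p0 := marginal_ge0 S [set v] mf.
have q0 := marginal_ge0 S [set v] mg.
have x0 := marginal_ge0 S [set u] mf.
have y0 := marginal_ge0 S [set u] mg.
case: (eqVneq (marginal g [set v] S) 0) => [-> _|qn] /=.
  by rewrite mul0r mulr_ge0.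
case: (eqVneq (marginal g [set u] S) 0) => [->|yn] /=.
  (* The maximal ratio is finite here, so the ratio of [u] cannot be [+oo]. *)
  by case: (eqVneq (marginal f [set u] S) 0) => [->|_] /=; rewrite ?mulr0 ?leye_eq.
rewrite lee_fin ler_pdivrMr ?lt_def ?yn// mulrAC ler_pdivlMr ?lt_def ?qn//.
by rewrite mulrC.
Qed.

(** * Estimates along the greedy run *)

Section Greedy.
Context {f g : {set V} -> R} {r0 : \bar R} {S_ : nat -> {set V}} {k : nat}.
Hypotheses (mf : monotone f) (sf : submodular f).
Hypotheses (mg : monotone g) (sg : supermodular g).
Hypothesis S_greedy : greedy_ratio_marginal r0 f g S_ k.

Let df i : R := f (S_ i.+1) - f (S_ i).
Let dg i : R := g (S_ i.+1) - g (S_ i).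

Lemma greedy_subset {i j} : (i <= j <= k)%N -> S_ i \subset S_ j.
Proof.
elim: j => [|j IH]; first by rewrite leqn0 => /andP[/eqP ->].
rewrite leq_eqVlt ltnS => /andP[/predU1P[->//|ij] jk].
apply: subset_trans (IH _) _; first by rewrite ij ltnW.
by have [_ /(_ _ jk)[v _ ->]] := S_greedy; exact: subsetUl.
Qed.

(** The element chosen at step [i] was available at step [j] and did not beat the choice made there;
    since then its [f]-marginal can only have dropped and its [g]-marginal grown. *)
Lemma greedy_ratio_nonincreasing {i j} : (j <= i < k)%N ->
  df i * dg j <= df j * dg i.
Proof.
move=> /andP[ji ik]; have jk := leq_ltn_trans ji ik.
have [_ St] := S_greedy.
have [u [uS _] Eu] := St _ ik; have [v cv Ev] := St _ jk.
have Sji : S_ j \subset S_ i by apply: greedy_subset; rewrite ji ltnW.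
have uSj : u \notin S_ j by apply: contra uS; exact: subsetP Sji u.
have := greedy_choice_cross mf mg cv uSj.
have := sf _ _ _ Sji uS; have := sg _ _ _ Sji uS.
have p0 := marginal_ge0 (S_ j) [set v] mf.
have q0 := marginal_ge0 (S_ j) [set v] mg.
rewrite /df /dg Eu Ev -!/(marginal _ _ _) => Hg Hf H.
rewrite mulrC; apply: le_trans (ler_wpM2l q0 Hf) _.
exact: le_trans H (ler_wpM2l p0 Hg).
Qed.

Hypothesis f0 : normalized f.
Hypothesis g0 : normalized g.
Hypothesis cf : submodular_curvature f <= 1.

(** Induction on [j] with [i] fixed. A new [v] outside [Y] raises [f (S_ j :|: Y)] by at least [a *
    f [set v]], hence by [a * df j], and [g (S_ j :\: Y)] by at most [dg j]; the nonincreasing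
    ratios pass from [j] to [i]. *)
Lemma greedy_curvature_gain {i} Y : (i < k)%N -> forall j, (j <= i)%N ->
  df i * ((1 - submodular_curvature f) * g (S_ j :\: Y))
    <= dg i * (f (S_ j :|: Y) - f Y).
Proof.
move=> ik; have [S0 St] := S_greedy.
have df0 : 0 <= df i by have [v _ E] := St _ ik; rewrite /df E marginal_ge0.
have dg0 : 0 <= dg i by have [v _ E] := St _ ik; rewrite /dg E marginal_ge0.
elim=> [|j IH] ji; first by rewrite S0 set0D set0U g0 subrr !mulr0.
have jk := ltn_trans ji ik.
have [v [vS _] E] := St _ jk; have {}IH := IH (ltnW ji).
case: (boolP (v \in Y)) => vY.
  have -> : S_ j.+1 :\: Y = S_ j :\: Y.
    by rewrite E; apply/setP => x; rewrite !inE; case: eqP => [->|_]; rewrite ?vY ?orbF.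
  have -> : S_ j.+1 :|: Y = S_ j :|: Y.
    by rewrite E -setUA; congr (_ :|: _); apply/setUidPr; rewrite sub1set.
  exact: IH.
have eD : S_ j.+1 :\: Y = S_ j :\: Y :|: [set v].
  rewrite E setDUl; congr (_ :|: _); apply/setDidPl.
  by rewrite disjoints_subset sub1set inE.
have eU : S_ j.+1 :|: Y = S_ j :|: Y :|: [set v] by rewrite E setUAC.
have vU : v \notin S_ j :|: Y by rewrite inE negb_or vS.
have Hg := sg _ _ _ (subsetDl (S_ j) Y) vS.
have fv : 0 <= f [set v] by rewrite -[X in X <= _]f0 mf// sub0set.
have Hf := submodular_curvature_marginal mf fv vU.
have Hv : marginal f [set v] (S_ j) <= f [set v].
  by have := sf _ _ _ (sub0set (S_ j)) vS; rewrite {2}/marginal set0U f0 subr0.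
rewrite {}eD {}eU; have := greedy_ratio_nonincreasing (i := i) (j := j).
rewrite ik (ltnW ji) => /(_ isT); rewrite [dg j]/dg [df j]/df E -!/(marginal _ _ _) => Hr.
set a := 1 - _ in IH Hf *.
have a0 : 0 <= a by rewrite subr_ge0.
have h1 := ler_wpM2l dg0 Hf.
have h2 := ler_wpM2l (mulr_ge0 dg0 a0) Hv.
have h3 := ler_wpM2l a0 Hr.
have h4 := ler_wpM2l (mulr_ge0 df0 a0) Hg.
move: h1 h2 h3 h4 IH; rewrite /marginal; move: (df i) (dg i) => p q; lra.
Qed.

Lemma greedy_step {theta Y i} : (forall A, 0 <= g A) ->
  0 <= submodular_curvature f -> 0 <= supermodular_curvature g < 1 ->
  (i < k)%N -> g (S_ i) <= theta -> g Y <= theta ->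
  dg i * (f Y - f (S_ i)) <=
  df i * (theta / (1 - supermodular_curvature g)
          - (1 - submodular_curvature f) * g (S_ i)).
Proof.
move=> g_ge0 cf0 cg ik gS gY; have [_ St] := S_greedy.
have [v cv E] := St _ ik.
have df0 : 0 <= df i by rewrite /df E marginal_ge0.
have dg0 : 0 <= dg i by rewrite /dg E marginal_ge0.
have h1 : dg i * marginal f Y (S_ i) <= df i * marginal g Y (S_ i).
  apply: marginal_ratio_set => // u uS; rewrite /dg /df E.
  exact: (greedy_choice_cross mf mg cv uS).
have h2 := greedy_curvature_gain Y ik i (leqnn i).
have gSD : g (S_ i :\: Y) <= g (S_ i) by apply: mg; exact: subsetDl.
have := supermodular_curvature_budget mg g_ge0 cg (le_trans gSD gS) gY.
have cg0 : 0 < 1 - supermodular_curvature g by lra.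
rewrite mulrC -ler_pdivlMr// /marginal.
have -> : S_ i :\: Y :|: Y = S_ i :|: Y.
  by apply/setP => x; rewrite !inE; case: (x \in Y); rewrite ?orbT ?orbF.
set t := theta / _; set a := 1 - _ in h2 *; rewrite /marginal in h1 => h3.
have a01 : 0 <= a <= 1 by rewrite subr_ge0 cf gerBl.
have h4 := ler_wpM2l df0 h3.
(* Splitting [g(Y | S_i)] at [S_ i :\: Y] and subtracting the curvature gain leaves
   [(1 - a) * g (S_ i :\: Y)]. *)
have : df i * ((1 - a) * g (S_ i :\: Y)) <= df i * ((1 - a) * g (S_ i)).
  by rewrite !ler_wpM2l// subr_ge0; case/andP: a01.
by move: h1 h2 h4; rewrite /marginal; move: (df i) (dg i) => p q; lra.
Qed.

End Greedy.
End SetFunctions.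

(** * Solving the recursion *)

(* The continuous analogue of the recursion is F' = (opt - F) / (t - a x), with
   solution opt - F = opt (1 - a x / t)^(1/a); truncating G at theta absorbs the
   overshoot of the last step. *)
Lemma truncated_recursion {R : realType} {k : nat} {F G : nat -> R} {opt a t theta : R} :
  0 < a <= 1 -> 0 < theta -> theta <= t -> F 0%N = 0 -> G 0%N = 0 -> 0 <= opt ->
  (forall i, (i < k)%N -> F i <= F i.+1) ->
  (forall i, (i < k)%N -> G i <= theta) ->
  (forall i, (i < k)%N ->
    (G i.+1 - G i) * (opt - F i) <= (F i.+1 - F i) * (t - a * G i)) ->
  theta <= G k ->
  opt - F k <= opt * (1 - a * (theta / t)) `^ (1 / a).
Proof.
move=> /andP[a0 a1] th0 tht F0 G0 opt0 Fm Gt rec Gk.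
have t0 : 0 < t by lra.
pose H i := Num.min (G i) theta.
pose M i := 1 - a * (H i / t).
have Mge i : 0 <= M i.
  have : H i / t <= 1 by rewrite ler_pdivrMr// mul1r ge_min tht orbT.
  rewrite /M => Hi; have := ler_wpM2l (ltW a0) Hi; lra.
have s1 : 1 <= 1 / a by rewrite ler_pdivlMr// mul1r.
suff /(_ k (leqnn k)) : forall i, (i <= k)%N -> opt - F i <= opt * M i `^ (1 / a).
  by rewrite /M /H min_r.
elim=> [|i IH] ik.
  by rewrite F0 /M /H G0 min_l ?(ltW th0)// mul0r mulr0 !subr0 powR1 mulr1.
have {}IH := IH (ltnW ik).
have Fi := Fm i ik.
have Rge j : 0 <= opt * M j `^ (1 / a) by rewrite mulr_ge0// powR_ge0.
(* If [F i] exceeds [opt], so does [F i.+1], and the bound is trivial. *)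
have [Dneg|Dpos] := ltP (opt - F i) 0.
  by apply: le_trans (Rge _); lra.
(* Truncation can affect only [H i.+1], so the increment of [H] is at most that of [G]. *)
have Hi : H i = G i by rewrite /H min_l// Gt.
have HG : H i.+1 - H i <= G i.+1 - G i by rewrite Hi lerB// ge_min lexx.
have step : (H i.+1 - H i) * (opt - F i) <= (F i.+1 - F i) * (M i * t).
  apply: le_trans (ler_wpM2r Dpos HG) _; apply: le_trans (rec i ik) _.
  by rewrite /M Hi [(1 - _) * t]mulrBl mul1r -[a * _ * t]mulrA divfK ?gt_eqF.
(* Division by [M i = 0] is excluded, but then the induction hypothesis already gives
   [opt <= F i]. *)
have [M0|MN0] := eqVneq (M i) 0.
  apply: le_trans (Rge _); move: IH; rewrite M0 powR0 ?mulr0; first lra.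
  by rewrite gt_eqF//; lra.
have M0 : 0 < M i by rewrite lt_def MN0 Mge.
have Mt0 : 0 < M i * t by rewrite mulr_gt0.
have E : M i.+1 = M i * (M i.+1 / M i) by rewrite mulrC divfK.
have r0 : 0 <= M i.+1 / M i by rewrite divr_ge0.
rewrite E powRM// mulrA.
apply: le_trans (ler_wpM2r (powR_ge0 _ _) IH).
apply: le_trans (ler_wpM2l Dpos (powR_bernoulli _ _ s1 r0)).
(* The Bernoulli factor [1 / a] cancels the slope [a] of [M], leaving the decrease that [step]
   controls. *)
have -> : 1 + 1 / a * (M i.+1 / M i - 1) = 1 - (H i.+1 - H i) / (M i * t).
  have -> : M i.+1 = M i - a * ((H i.+1 - H i) / t) by rewrite /M; ring.
  by field; rewrite !gt_eqF.
have : (H i.+1 - H i) / (M i * t) * (opt - F i) <= F i.+1 - F i.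
  by rewrite mulrAC ler_pdivrMr.
lra.
Qed.

Theorem mainTheorem7 (R : realType) (V : finType) (f g : {set V} -> R)
    (c gamma theta : R) (r0 : \bar R)
    (Sstar : {set V}) (S_ : nat -> {set V}) (k : nat)
    (f_ge0 : forall S, 0 <= f S) (f_normalized : normalized f)
    (f_monotone : monotone f) (f_submodular : submodular f)
    (c_def : c = submodular_curvature f) (c_range : 0 <= c < 1)
    (g_ge0 : forall S, 0 <= g S) (g_normalized : normalized g)
    (g_monotone : monotone g) (g_supermodular : supermodular g)
    (gamma_def : gamma = supermodular_curvature g) (gamma_range : 0 <= gamma < 1)
    (theta_gt0 : 0 < theta)
    (Sstar_opt : optimal_solution f g theta Sstar)
    (S_greedy : greedy_ratio_marginal r0 f g S_ k)
    (k_first : first_overshoot g theta S_ k) :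
  (1 - (1 - (1 - c) * (1 - gamma)) `^ (1 / (1 - c))) * f Sstar <= f (S_ k).
Proof.
have [gk gi] := k_first; have [gY _] := Sstar_opt.
have S0 : S_ 0%N = set0 by case: S_greedy.
have b0 : 0 < 1 - gamma by lra.
have cf1 : submodular_curvature f <= 1 by lra.
(* The recursion is used with [t = theta / (1 - gamma)], so [theta / t] is [1 - gamma]. *)
have bE : theta / (theta / (1 - gamma)) = 1 - gamma.
  by field; rewrite !gt_eqF.
have : f Sstar - f (S_ k) <=
    f Sstar * (1 - (1 - c) * (theta / (theta / (1 - gamma)))) `^ (1 / (1 - c)).
  apply: (truncated_recursion (F := f \o S_) (G := g \o S_)) => //=.
  - lra.
  - by rewrite ler_pdivlMr// ler_piMr//; lra.
  - by rewrite S0.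
  - by rewrite S0.
  - by move=> i ik; apply: f_monotone; apply: (greedy_subset S_greedy); rewrite leqnSn.
  - move=> i ik; rewrite c_def gamma_def.
    apply: (greedy_step f_monotone f_submodular g_monotone g_supermodular S_greedy) => //.
    + by rewrite -c_def; case/andP: c_range.
    + by rewrite -gamma_def.
    + exact: gi.
  - exact: ltW.
rewrite bE mulrBl mul1r [f Sstar * _]mulrC; lra.
Qed.
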